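(* Let $d\ge3$ and let $K:\mathbb{S}^{d-1}\times\mathbb{S}^{d-1}\to\mathbb{C}$ be a Hermitian, axially symmetric kernel of the form $$K(\xi,\zeta)=\sum_{\ell_1=-\infty}^{\infty}\ \sum_{\ell,\ell'\in\Lambda_{|\ell_1|}}c_{\ell_1}(\ell,\ell')\,Y_{\ell_1,\ell}(\xi)\,\overline{Y_{\ell_1,\ell'}(\zeta)},\qquad \xi,\zeta\in\mathbb{S}^{d-1},$$ with $$\sum_{\ell_1=-\infty}^{\infty}\ \sum_{\ell,\ell'\in\Lambda_{|\ell_1|}}|c_{\ell_1}(\ell,\ell')|\,\frac{\sqrt{N_{\ell_{d-1},d}N_{\ell'_{d-1},d}}}{\sigma_{d-1}}<\infty ,$$ and suppose that every map $c_{\ell_1}:\Lambda_{|\ell_1|}\times\Lambda_{|\ell_1|}\to\mathbb{C}$, $\ell_1\in\mathbb{Z}$, is positive definite. Let $\mathcal{F}$ be the set of all $\ell_1\in\mathbb{Z}$ such that for every family $(d_\ell)_{\ell\in\Lambda_{|\ell_1|}}$ of complex numbers for which the following double series converges absolutely, $$\sum_{\ell,\ell'\in\Lambda_{|\ell_1|}}d_\ell\,c_{\ell_1}(\ell,\ell')\,\overline{d_{\ell'}}=0\quad\Longrightarrow\quad d_\ell=0\ \text{ for all }\ell\in\Lambda_{|\ell_1|}.$$ If $\mathcal{F}=\mathbb{Z}$, then $K$ is strictly positive definite on $\mathbb{S}^{d-1}$.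
   Context: A Hermitian kernel $K:\Omega\times\Omega\to\mathbb{C}$ ($K(x,y)=\overline{K(y,x)}$) is called positive definite (respectively strictly positive definite) on $\Omega$ if for every finite set $\Xi\subset\Omega$ of distinct points the matrix $(K(\xi,\zeta))_{\xi,\zeta\in\Xi}$ is positive semi-definite (respectively positive definite) on $\mathbb{C}^{|\Xi|}$. $\mathbb{S}^{d-1}$ is the unit sphere in $\mathbb{R}^d$ and $\sigma_{d-1}$ its surface area. $N_{0,d}=1$, $N_{j,d}=\frac{(2j+d-2)(j+d-3)!}{j!(d-2)!}$ for $j\ge1$. For $\ell_1\in\mathbb{Z}$, $\Lambda_{|\ell_1|}=\{\ell=(\ell_2,\ldots,\ell_{d-1})\in\mathbb{Z}^{d-2}:|\ell_1|\le\ell_2\le\cdots\le\ell_{d-1}\}$. In polar coordinates $\xi=(\theta_1,\ldots,\theta_{d-1})$, $\theta_1\in[0,2\pi)$, $\theta_j\in[0,\pi]$ for $j\ge2$ ($\xi_d=\cos\theta_{d-1}$, $\xi_{d-1}=\sin\theta_{d-1}\cos\theta_{d-2}$, ..., $\xi_2=\sin\theta_{d-1}\cdots\sin\theta_2\sin\theta_1$, $\xi_1=\sin\theta_{d-1}\cdots\sin\theta_2\cos\theta_1$), the functions $$Y_{\ell_1,\ell}(\xi)=Y_{\ell_1,\ldots,\ell_{d-1}}(\xi)=\frac{1}{\sqrt{2\pi}}e^{i\ell_1\theta_1}\prod_{j=2}^{d-1}{}_{j}\tilde P_{\ell_j}^{\ell_{j-1}}(\theta_j)$$ form an orthonormal basis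 of $L^2(\mathbb{S}^{d-1})$ of spherical harmonics ($Y_{\ell_1,\ell}$ has degree $\ell_{d-1}$), where ${}_{j}\tilde P_{L}^{\ell}(\theta)={}_{j}c_L^{\ell}(\sin\theta)^{(2-j)/2}P_{L+(j-2)/2}^{-(\ell+(j-2)/2)}(\cos\theta)$ (extended continuously to $\theta\in\{0,\pi\}$), $P_\nu^\mu$ are the associated Legendre functions on $(-1,1)$ and ${}_{j}c_L^{\ell}=\left(\frac{2L+j-1}{2}\frac{(L+\ell+j-2)!}{(L-\ell)!}\right)^{1/2}$. Axially symmetric means invariant under simultaneous rotation $\theta_1\mapsto\theta_1+\alpha$ of both arguments for every $\alpha$ (every kernel of the displayed form has this property). *)

(* Defs.v *)
From mathcomp Require Import all_boot all_order all_algebra sesquilinear spectral.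
From mathcomp Require Import finmap complex.
From mathcomp Require Import all_classical all_reals all_analysis.
From mathcomp.analysis Require showcase.summability.

Set Implicit Arguments.
Unset Strict Implicit.
Unset Printing Implicit Defensive.

Import Order.TTheory GRing.Theory Num.Theory.
Import numFieldNormedType.Exports.

Local Open Scope classical_set_scope.
Local Open Scope complex_scope.
Local Open Scope sesquilinear_scope.
Local Open Scope ring_scope.

Section Kernels.
Variables (C : numClosedFieldType) (Omega : eqType).
Implicit Types K : Omega -> Omega -> C.

Definition kernel_mx K n (x : 'I_n -> Omega) : 'M[C]_n :=
  \matrix_(i, j) K (x i) (x j).

Definition psd_mx n (M : 'M[C]_n) : Prop :=
  forall v : 'cV[C]_n, 0 <= (v ^t* *m M *m v) 0 0.

Definition pd_mx n (M : 'M[C]_n) : Prop :=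
  forall v : 'cV[C]_n, v != 0 -> 0 < (v ^t* *m M *m v) 0 0.

Definition hermitian_kernel K : Prop := forall x y, K x y = (K y x)^*.

(* A finite set of distinct points is given by an injective enumeration. *)
Definition positive_definite K : Prop :=
  hermitian_kernel K /\
  forall n (x : 'I_n -> Omega), injective x -> psd_mx (kernel_mx K x).

Definition strictly_positive_definite K : Prop :=
  hermitian_kernel K /\
  forall n (x : 'I_n -> Omega), injective x -> pd_mx (kernel_mx K x).

End Kernels.

(* Unconditional summation, along the net of finite subsets of I; in C it is
   equivalent to absolute convergence with sum s. *)
Definition has_sum (C : numFieldType) (I : choiceType) (a : I -> C) (s : C) :=
  summability.partial_sum a @ summability.totally --> s.

Definition abs_summable (R : realType) (I : choiceType) (a : I -> R[i]) : Prop :=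
  (\esum_(i in [set: I]) (Normc.normc (a i))%:E < +oo)%E.

Section Legendre.
Variable R : realType.
Implicit Types (a b c x z mu nu t : R).

Definition poch x (n : nat) : R := \prod_(i < n) (x + i%:R).

(* 1 / Gamma(x), entire in x, from Euler's limit
   Gamma(x) = lim n! n^x / (x (x + 1) ... (x + n)). *)
Definition rgamma x : R :=
  limn (fun n : nat => poch x n.+1 / (n`!%:R * n%:R `^ x)).

(* Gauss' series 2F1(a, b; c; z) / Gamma(c), meaningful for every real c. *)
Definition hyp2F1_reg a b c z : R :=
  limn (series (fun k : nat =>
    poch a k * poch b k / k`!%:R * rgamma (c + k%:R) * z ^+ k)).

(* The associated Legendre function P_nu^mu on the cut (-1, 1) (Ferrers
   function of the first kind) of real degree and order. *)
Definition legendreP nu mu x : R :=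
  ((1 + x) / (1 - x)) `^ (mu / 2) *
  hyp2F1_reg (nu + 1) (- nu) (1 - mu) ((1 - x) / 2).

Definition tP_norm (j : nat) (L l : int) : R :=
  Num.sqrt ((2 * L + j%:Z - 1)%:~R / 2 *
            (`|(L + l + j%:Z - 2)%R|%N`!%:R / `|(L - l)%R|%N`!%:R)).

Definition tP_open (j : nat) (L l : int) t : R :=
  tP_norm j L l * sin t `^ ((2 - j%:R) / 2) *
  legendreP (L%:~R + (j%:R - 2) / 2) (- (l%:~R + (j%:R - 2) / 2)) (cos t).

Definition tP (j : nat) (L l : int) t : R :=
  if (0 < t) && (t < pi) then tP_open j L l t
  else lim (tP_open j L l s @[s --> within `]0, pi[ (nbhs t)]).

End Legendre.

Section Sphere.
Variables (R : realType) (d : nat).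

Definition sphere : Type := {x : 'rV[R]_d | \sum_i x 0 i ^+ 2 == 1}.

(* Angles theta_1, ..., theta_(d-1) are the values at 1, ..., d - 1 of a
   function on nat; the 0-based column i holds the coordinate xi_(i+1). *)
Definition polar (theta : nat -> R) : 'rV[R]_d :=
  \row_(i < d)
    ((if i == 0%N :> nat then cos (theta 1%N)
      else if i == 1%N :> nat then sin (theta 1%N) else cos (theta i)) *
     \prod_(maxn 2 i.+1 <= j < d) sin (theta j)).

Definition polar_coords (theta : nat -> R) (xi : sphere) : Prop :=
  [/\ 0 <= theta 1%N < 2 * pi,
      forall j, (2 <= j < d)%N -> 0 <= theta j <= pi
    & val xi = polar theta].

Definition rot1 (alpha : R) (theta : nat -> R) : nat -> R :=
  fun j => if j == 1%N then theta j + alpha else theta j.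

Definition axially_symmetric (K : sphere -> sphere -> R[i]) : Prop :=
  forall (alpha : R) (theta phi : nat -> R) (xi zeta xi' zeta' : sphere),
    polar_coords theta xi -> polar_coords phi zeta ->
    val xi' = polar (rot1 alpha theta) -> val zeta' = polar (rot1 alpha phi) ->
    K xi' zeta' = K xi zeta.

(* 2 pi^(d/2) / Gamma(d/2) *)
Definition sphere_area : R := 2 * pi `^ (d%:R / 2) * rgamma (d%:R / 2).

(* Meant for 3 <= d, where no truncated subtraction underflows. *)
Definition harm_dim (j : nat) : R :=
  if j == 0%N then 1
  else ((2 * j + d - 2) * (j + d - 3)`!)%:R / (j`! * (d - 2)`!)%:R.

(* l = (l_2, ..., l_(d-1)) with |l_1| <= l_2 <= ... <= l_(d-1) *)
Definition Lambda (l1 : int) : Type :=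
  {l : (d - 2).-tuple int | path <=%R `|l1| l}.

(* (l_1, l)_j, for 1 <= j <= d - 1 *)
Definition mindex (l1 : int) (l : Lambda l1) (j : nat) : int :=
  nth 0 (l1 :: val l) j.-1.

Definition degree (l1 : int) (l : Lambda l1) : nat := `|mindex l d.-1|%N.

Definition Yangles (l1 : int) (l : Lambda l1) (theta : nat -> R) : R[i] :=
  (1 / Num.sqrt (2 * pi))%:C *
  (cos (l1%:~R * theta 1%N) +i* sin (l1%:~R * theta 1%N)) *
  (\prod_(2 <= j < d) tP j (mindex l j) (mindex l j.-1) (theta j))%:C.

(* Polar coordinates are not unique where some sin theta_j vanishes (j >= 2);
   the value of Y does not depend on the ones that are chosen. *)
Definition Y (l1 : int) (l : Lambda l1) (xi : sphere) : R[i] :=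
  Yangles l (xget (fun=> 0) [set theta | polar_coords theta xi]).

Definition coeff_index : choiceType :=
  {l1 : int & (Lambda l1 * Lambda l1)%type}.

Definition coeffs : Type := forall l1 : int, Lambda l1 -> Lambda l1 -> R[i].

Definition coeffs_summable (c : coeffs) : Prop :=
  (\esum_(p in [set: coeff_index])
     (Normc.normc (c (tag p) (tagged p).1 (tagged p).2) *
      (Num.sqrt (harm_dim (degree (tagged p).1) * harm_dim (degree (tagged p).2))
       / sphere_area))%:E < +oo)%E.

Definition has_expansion (K : sphere -> sphere -> R[i]) (c : coeffs) : Prop :=
  forall xi zeta : sphere,
    has_sum (fun p : coeff_index =>
               c (tag p) (tagged p).1 (tagged p).2 *
               Y (tagged p).1 xi * (Y (tagged p).2 zeta)^*)
            (K xi zeta).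

Definition calF (c : coeffs) : set int :=
  [set l1 | forall a : Lambda l1 -> R[i],
     let term := fun p : Lambda l1 * Lambda l1 =>
                   a p.1 * c l1 p.1 p.2 * (a p.2)^* in
     abs_summable term -> has_sum term 0 -> forall l, a l = 0].

End Sphere.

(* Main.v *)
Require Import Defs.
From mathcomp Require Import all_boot all_order all_algebra complex.
From mathcomp Require Import all_classical all_reals all_analysis.
From mathcomp Require Import sesquilinear finmap ring lra zify.
From mathcomp.analysis Require showcase.summability.

Set Implicit Arguments.
Unset Strict Implicit.
Unset Printing Implicit Defensive.

Import Order.TTheory GRing.Theory Num.Theory.
Import numFieldNormedType.Exports.

Local Open Scope classical_set_scope.
Local Open Scope ring_scope.

(* For points x_i and a vector v put a_(l1, l) = sum_i conj(v_i) Y_(l1, l)(x_i).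
   Substituting the expansion of K, v^* K v is the sum over l1 of the quadratic
   forms of c_l1 at a_(l1, .), which are nonnegative.  If it is 0, each of them
   is 0, so F = Z gives sum_i conj(v_i) Y_(l1, l)(x_i) = 0 for all l1 and l, and
   it remains to see that the functions Y separate points linearly.

   With m = l + (j - 2) / 2, the series of P_(m+n)^(-m) obeys in n the three-term
   recurrence of Gegenbauer polynomials and starts from the binomial series
   (1 - z)^m, so jP~_(l+n)^l is sin^l times a polynomial of degree exactly n in
   the cosine.  Letting the last degree vary, such a relation therefore splits
   according to the value of cos theta_(d-1), and one descends to the dimension
   below, down to a Vandermonde system in exp(i theta_1), for which l1 >= 0
   suffices.  At the poles sin theta_(d-1) = 0 only one point is left, where
   Y_(0, 0) does not vanish. *)

(** * The reciprocal Gamma function *)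

Lemma poch0 (R : realType) (x : R) : poch x 0 = 1.
Proof. by rewrite /poch big_ord0. Qed.

Lemma pochSr (R : realType) (x : R) n : poch x n.+1 = poch x n * (x + n%:R).
Proof. by rewrite /poch big_ord_recr. Qed.

Lemma pochSl (R : realType) (x : R) n : poch x n.+1 = x * poch (x + 1) n.
Proof.
rewrite /poch big_ord_recl /= addr0; congr (_ * _).
by apply: eq_bigr => i _; rewrite -addrA -natr1 (addrC 1).
Qed.

Lemma poch_gt0 (R : realType) (x : R) n : 0 < x -> 0 < poch x n.
Proof. by move=> x0; apply: prodr_gt0 => i _; rewrite ltr_wpDr. Qed.

(** From exp(-u) >= 1 - u at u = 1/(s + 1) one gets exp(1/(s + 1)) <= 1 + 1/s. Raising this to the
    power x and using 1 + u <= exp u covers every x >= 0, also below 1. *)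
Lemma one_plus_le_powR (R : realType) (x s : R) : 0 <= x -> 0 < s ->
  1 + x / (s + 1) <= (1 + s^-1) `^ x.
Proof.
move=> x0 s0.
have s1 : 0 < s + 1 by rewrite addr_gt0.
have h1 : expR ((s + 1)^-1) <= 1 + s^-1.
  have := expR_ge1Dx (- (s + 1)^-1); rewrite expRN => h.
  have e : 1 - (s + 1)^-1 = (1 + s^-1)^-1 by field; lra.
  move: h; rewrite e lef_pV2 ?posrE ?expR_gt0 // addr_gt0 ?invr_gt0 //.
apply: (le_trans (expR_ge1Dx _)).
rewrite mulrC expRM; apply: ge0_ler_powR => //; rewrite nnegrE ?expR_ge0 //.
by rewrite addr_ge0 // invr_ge0 ltW.
Qed.

(** The left side is at most exp(x / (s + x)), whose inverse is at least 1 - x / (s + x) = 1 / (1 +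
    x / s). *)
Lemma powR_le_one_plus (R : realType) (x s : R) : 0 <= x -> 0 < s ->
  (1 + (s + x)^-1) `^ x <= 1 + x / s.
Proof.
move=> x0 s0.
have sx : 0 < s + x by rewrite ltr_wpDr.
have h1 : (1 + (s + x)^-1) `^ x <= expR (x / (s + x)).
  rewrite (mulrC x) expRM; apply: ge0_ler_powR; rewrite ?nnegrE ?expR_ge0 //.
    by rewrite addr_ge0 // invr_ge0 ltW.
  exact: expR_ge1Dx.
apply: (le_trans h1).
have := expR_ge1Dx (- (x / (s + x))); rewrite expRN.
have -> : 1 - x / (s + x) = (1 + x / s)^-1 by field; lra.
by rewrite lef_pV2 ?posrE ?expR_gt0 // ltr_pwDl // divr_ge0 // ltW.
Qed.

Definition rgamma_seq (R : realType) (x : R) (n : nat) : R :=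
  poch x n.+1 / (n`!%:R * n%:R `^ x).

(** With N = n + 1 the quotient of the two terms is (1 + x/(N + 1)) / (1 + 1/N)^x. Index 0 is left
    out: the power 0^x = 0 in its denominator makes that term 0. *)
Lemma rgamma_seq_nonincr (R : realType) (x : R) n : 0 < x ->
  rgamma_seq x n.+2 <= rgamma_seq x n.+1.
Proof.
move=> x0; rewrite /rgamma_seq (pochSr x n.+2) factS.
set N : R := n.+1%:R; have N0 : 0 < N by rewrite ltr0n.
have -> : n.+2%:R = N + 1 :> R by rewrite /N -natr1.
have h := one_plus_le_powR (ltW x0) N0.
have -> : (N + 1) `^ x = N `^ x * (1 + N^-1) `^ x.
  rewrite -powRM ?mulrDr ?mulr1 ?divff ?gt_eqF ?ltW //.
  by rewrite addr_gt0 // invr_gt0.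
have p0 : 0 < N `^ x by rewrite powR_gt0.
have q0 : 0 < (1 + N^-1) `^ x by rewrite powR_gt0 // addr_gt0 // invr_gt0.
have f0 : 0 < n.+1`!%:R :> R by rewrite ltr0n fact_gt0.
have r0 := poch_gt0 n.+2 x0.
rewrite natrM -[n.+2%:R]natr1 -/N.
rewrite [X in _ <= X](_ : _ = poch x n.+2 * (N + 1 + x) /
    ((N + 1) * n.+1`!%:R * (N `^ x * (1 + x / (N + 1))))); last first.
  field; rewrite !gt_eqF //; lra.
have -> : x + (N + 1) = N + 1 + x by ring.
rewrite ler_pM2l ?mulr_gt0 //; last lra.
rewrite lef_pV2 ?posrE ?mulr_gt0 //; try lra.
  by rewrite ler_pM2l ?ler_pM2l ?mulr_gt0 //; lra.
by rewrite ltr_pwDl // divr_ge0; lra.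
Qed.

(* With n + 1 + x in place of n in Euler's sequence it becomes nondecreasing,
   hence the limit is not 0. *)
Lemma rgamma_seq_lower (R : realType) (x : R) n : 0 < x ->
  x / (1 + x) `^ x <= poch x n.+1 / (n`!%:R * (n%:R + 1 + x) `^ x).
Proof.
move=> x0; elim: n => [|n IH].
  by rewrite pochSr poch0 fact0 !mul1r addr0 add0r.
apply: (le_trans IH); rewrite (pochSr x n.+1) factS.
set N : R := n%:R + 1; have N0 : 0 < N by rewrite ltr_wpDl.
have -> : n.+1%:R = N by rewrite -natr1.
have h := powR_le_one_plus (ltW x0) N0.
have -> : (N + 1 + x) `^ x = (N + x) `^ x * (1 + (N + x)^-1) `^ x.
  rewrite -powRM ?mulrDr ?mulr1 ?divff; try lra.
    by congr (_ `^ _); ring.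
  by rewrite addr_ge0 // invr_ge0; lra.
have p0 : 0 < (N + x) `^ x by rewrite powR_gt0; lra.
have q0 : 0 < (1 + (N + x)^-1) `^ x.
  by rewrite powR_gt0 // addr_gt0 // invr_gt0; lra.
have f0 : 0 < n`!%:R :> R by rewrite ltr0n fact_gt0.
have r0 := poch_gt0 n.+1 x0.
rewrite natrM -[n.+1%:R]natr1 -/N.
rewrite [X in X <= _](_ : _ = poch x n.+1 * (x + N) /
    (N * n`!%:R * ((N + x) `^ x * (1 + x / N)))); last first.
  field; rewrite !gt_eqF //; lra.
rewrite ler_pM2l ?mulr_gt0 //; last lra.
rewrite lef_pV2 ?posrE ?mulr_gt0 //; last by rewrite ltr_pwDl // divr_ge0; lra.
by rewrite ler_pM2l ?ler_pM2l ?mulr_gt0 //; lra.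
Qed.

Lemma rgamma_seq_lbound (R : realType) (x : R) n : 0 < x ->
  x / (1 + x) `^ x <= rgamma_seq x n.+1.
Proof.
move=> x0; apply: (le_trans (rgamma_seq_lower n.+1 x0)).
have r0 := poch_gt0 n.+2 x0.
have f0 : 0 < n.+1`!%:R :> R by rewrite ltr0n fact_gt0.
rewrite /rgamma_seq ler_pM2l // lef_pV2 ?posrE ?mulr_gt0 ?powR_gt0 //; last 1 first.
  by rewrite !ltr_wpDl.
rewrite ler_pM2l // ge0_ler_powR ?nnegrE //; try lra; have n0 : 0 <= n.+1%:R :> R by []; lra.
Qed.

Lemma cvg_rgamma_seq (R : realType) (x : R) : 0 < x ->
  rgamma_seq x n @[n --> \oo] --> rgamma x.
Proof.
move=> x0; suff : cvgn (rgamma_seq x) by [].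
have /cvg_ex[l hl] : cvgn (fun n => rgamma_seq x n.+1).
  apply: nonincreasing_is_cvgn.
    by apply/nonincreasing_seqP => n; exact: rgamma_seq_nonincr.
  by exists (x / (1 + x) `^ x) => _ [n _ <-]; exact: rgamma_seq_lbound.
by apply/cvg_ex; exists l; rewrite -(cvg_shiftS (rgamma_seq x)).
Qed.

Lemma rgamma_gt0 (R : realType) (x : R) : 0 < x -> 0 < rgamma x.
Proof.
move=> x0; have p0 : 0 < x / (1 + x) `^ x.
  by rewrite divr_gt0 // powR_gt0; lra.
apply: (lt_le_trans p0).
have := cvg_rgamma_seq x0; rewrite -(cvg_shiftS (rgamma_seq x)) => h.
rewrite -(cvg_lim _ h) //; apply: limr_ge; first by apply/cvg_ex; exists (rgamma x).
by apply: nearW => n; exact: rgamma_seq_lbound.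
Qed.

(** At index n + 1, Euler's term at x + 1 is the term at x times (1 + (x + 1)/(n + 1)) / x. *)
Lemma rgammaS (R : realType) (x : R) : 0 < x -> rgamma (x + 1) = rgamma x / x.
Proof.
move=> x0; have x1 : 0 < x + 1 by lra.
have h1 : rgamma_seq (x + 1) n.+1 @[n --> \oo] --> rgamma (x + 1).
  by have := cvg_rgamma_seq x1; rewrite -(cvg_shiftS (rgamma_seq (x + 1))).
have h2 : rgamma_seq x n.+1 * (x^-1 * (1 + (x + 1) * harmonic n)) @[n --> \oo]
    --> rgamma x * (x^-1 * (1 + (x + 1) * 0)).
  apply: cvgM; first by have := cvg_rgamma_seq x0; rewrite -(cvg_shiftS (rgamma_seq x)).
  apply: cvgMl_tmp; apply: cvgD; first exact: cvg_cst.
  by apply: cvgMl_tmp; exact: cvg_harmonic.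
rewrite mulr0 addr0 mulr1 in h2.
apply: (cvg_unique _ h1) => //.
suff -> : (fun n => rgamma_seq (x + 1) n.+1) =
          (fun n => rgamma_seq x n.+1 * (x^-1 * (1 + (x + 1) * harmonic n))) by [].
apply/funext => n; rewrite /rgamma_seq /harmonic.
set N : R := n.+1%:R; have N0 : 0 < N by rewrite ltr0n.
have f0 : 0 < n.+1`!%:R :> R by rewrite ltr0n fact_gt0.
have p0 : 0 < N `^ x by rewrite powR_gt0.
rewrite powRD ?(gt_eqF N0) ?implybT // powRr1 ?ltW //.
have := pochSl x n.+2; rewrite pochSr => e.
have -> : poch (x + 1) n.+2 = poch x n.+2 * (x + n.+2%:R) / x.
  by rewrite e mulrAC divff ?mul1r // gt_eqF.
rewrite -[n.+2%:R]natr1 /= -/N; field; by rewrite !gt_eqF.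
Qed.

Lemma rgammaD (R : realType) (x : R) k : 0 < x ->
  rgamma (x + k%:R) = rgamma x / poch x k.
Proof.
move=> x0; elim: k => [|k IH]; first by rewrite addr0 poch0 divr1.
rewrite -natr1 addrA rgammaS; last by rewrite ltr_wpDr.
by rewrite IH pochSr invfM mulrA.
Qed.
(** * The binomial series *)

Lemma bounded_of_eventually_nonincr (R : realType) (e : nat -> R) N :
  (forall k, (N <= k)%N -> `|e k.+1| <= `|e k|) -> exists2 M : R, 0 < M & forall k, `|e k| <= M.
Proof.
move=> eS; exists (1 + \sum_(i < N.+1) `|e i|).
  by rewrite ltr_pwDl // sumr_ge0.
have small k : (k < N.+1)%N -> `|e k| <= 1 + \sum_(i < N.+1) `|e i|.
  move=> kN; rewrite (bigD1 (Ordinal kN)) //= addrCA lerDl addr_ge0 //.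
  by rewrite sumr_ge0.
move=> k; have [|Nk] := ltnP k N.+1; first exact: small.
rewrite -(subnKC Nk); elim: (k - N.+1)%N => [|j IH]; rewrite ?addn0 ?addnS.
  by apply: (le_trans (eS _ _)) => //; exact: small.
by apply: (le_trans _ IH); apply: eS; exact: leq_trans (leqnSn _) (leq_addr _ _).
Qed.

(** The Taylor coefficient of z^k in (1 - z)^m. *)
Definition binom_coef (R : realType) (m : R) (k : nat) : R := poch (- m) k / k`!%:R.

Lemma binom_coefS (R : realType) (m : R) k :
  k.+1%:R * binom_coef m k.+1 = (k%:R - m) * binom_coef m k.
Proof.
rewrite /binom_coef pochSr factS natrM; field.
by rewrite (addrC 1) natr1 !pnatr_eq0 -lt0n fact_gt0.
Qed.

(** By [binom_coefS] these absolute values do not increase once k exceeds m. The factor k is kept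
    because the remainder in [binom_poly_ode] contains it. *)
Lemma binom_coef_bound (R : realType) (m : R) : 0 <= m ->
  exists2 M : R, 0 < M & forall k, `|k%:R * binom_coef m k| <= M.
Proof.
move=> m0; apply: (@bounded_of_eventually_nonincr _ _ (Num.truncn m).+1) => k mk.
have mk' : m < k%:R.
  apply: (lt_le_trans (truncnS_gt m)); by rewrite ler_nat.
rewrite binom_coefS !normrM ler_wpM2r // !ger0_norm //; first lra.
by rewrite subr_ge0 ltW.
Qed.

Definition binom_poly (R : realType) (m : R) (N : nat) : {poly R} :=
  \poly_(k < N) binom_coef m k.

(** (1 - z)^m solves (1 - z) y' + m y = 0; for the truncated series everything cancels except one
    top term. *)
Lemma binom_poly_ode (R : realType) (m : R) N (z : R) :
  (1 - z) * (binom_poly m N.+1)^`().[z] + m * (binom_poly m N.+1).[z] =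
  - (N.+1%:R * binom_coef m N.+1 * z ^+ N).
Proof.
have -> : (binom_poly m N.+1)^`() = \poly_(k < N) (k.+1%:R * binom_coef m k.+1).
  apply/polyP => i; rewrite coef_deriv !coef_poly ltnS.
  by case: ifP => _; rewrite ?mul0rn // mulr_natl.
rewrite !horner_poly; elim: N => [|N IH].
  rewrite big_ord0 big_ord1 expr0 mulr1 mulr0 add0r binom_coefS /binom_coef.
  by rewrite poch0 fact0; ring.
rewrite big_ord_recr [X in _ + m * X]big_ord_recr /= !mulrDr addrACA IH.
rewrite (binom_coefS m N.+1) !mulrA exprS; ring.
Qed.

Lemma is_derive_horner (R : realType) (p : {poly R}) (x : R) :
  is_derive x 1 (horner p) p^`().[x].
Proof.
apply: DeriveDef; first exact: derivable_horner.
by rewrite -derive1E -derivE.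
Qed.

(** Mean value theorem on [0, z] for p(y) (1 - y)^(-m), which is 1 at 0 and whose derivative follows
    from [binom_poly_ode]. *)
Lemma binom_poly_estimate (R : realType) (m z : R) N : 0 <= m -> 0 < z < 1 ->
  exists2 c : R, 0 < c < z & (binom_poly m N.+1).[z] * (1 - z) `^ (- m) - 1 =
    - (N.+1%:R * binom_coef m N.+1 * c ^+ N) * (1 - c) `^ (- m - 1) * z.
Proof.
move=> m0 /andP[z0 z1]; set p := binom_poly m N.+1.
pose g : R -> R := horner p * ((fun y => y `^ (- m)) \o (fun y => 1 - y)).
pose dg (c : R) : R := - (N.+1%:R * binom_coef m N.+1 * c ^+ N) * (1 - c) `^ (- m - 1).
have gd (c : R) : c < 1 -> is_derive c 1 g (dg c).
  move=> c1; have c0 : 0 < 1 - c by rewrite subr_gt0.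
  have h1 : is_derive c 1 (fun y : R => 1 - y) (0 - 1).
    by apply: is_deriveB.
  have h2 : is_derive (1 - c) 1 (fun y : R => y `^ (- m)) (- m * (1 - c) `^ (- m - 1)).
    exact: is_derive1_powR.
  have h3 := @is_derive1_comp _ _ (fun y : R => 1 - y) c _ _ h2 h1.
  have := is_deriveM (is_derive_horner p c) h3.
  set D := (D in is_derive _ _ _ D -> _); suff -> : dg c = D by [].
  rewrite /D /= /dg -binom_poly_ode -/p.
  have -> : (1 - c) `^ (- m) = (1 - c) `^ (- m - 1) * (1 - c).
    rewrite -[X in _ = _ * X]powRr1 ?ltW // -powRD ?subrK //.
    by rewrite (gt_eqF c0) implybT.
  rewrite /GRing.scale /=; ring.
have [||c] := @MVT _ g dg 0 z z0.
- by move=> x; rewrite in_itv /= => /andP[_ xz]; apply: gd; apply: lt_trans z1.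
- apply: derivable_within_continuous => x; rewrite in_itv /= => /andP[_ xz].
  by have [] := gd x (le_lt_trans xz z1).
rewrite in_itv /= => c0 h; exists c => //; move: h.
rewrite subr0 /dg /g /= => <-.
rewrite /GRing.mul /= subr0 powR1 mulr1; congr (_ - _).
rewrite horner_coef0 coef_poly /= /binom_coef poch0 fact0.
by rewrite divr1.
Qed.

Lemma binomial_series (R : realType) (m z : R) : 0 <= m -> 0 < z < 1 ->
  series (fun k => binom_coef m k * z ^+ k) @ \oo --> (1 - z) `^ m.
Proof.
move=> m0 /[dup] z01 /andP[z0 z1].
have [M M0 Mb] := binom_coef_bound m0.
have sE : (fun N => series (fun k => binom_coef m k * z ^+ k) N.+1) =
    (fun N => (binom_poly m N.+1).[z]).
  by apply/funext => N; rewrite horner_poly /series /= big_mkord.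
rewrite -(cvg_shiftS (series (fun k => binom_coef m k * z ^+ k))) sE.
have y0 : 0 < 1 - z by rewrite subr_gt0.
have w0 : 0 < (1 - z) `^ (- m) by rewrite powR_gt0.
suff h : (binom_poly m N.+1).[z] * (1 - z) `^ (- m) @[N --> \oo] --> (1 : R).
  have h2 := cvgMr_tmp (b := (1 - z) `^ m) h; rewrite mul1r in h2.
  suff e : (fun N => (binom_poly m N.+1).[z] * (1 - z) `^ (- m) * (1 - z) `^ m) =
           (fun N => (binom_poly m N.+1).[z]) by rewrite -e; exact: h2.
  apply/funext => N.
  by rewrite -mulrA -powRD ?(gt_eqF y0) ?implybT // addNr powRr0 mulr1.
(* The error in [binom_poly_estimate] is at most B z^N, since 0 < c < z bounds c^N and (1 -
   c)^(-m-1) by their values at z. *)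
pose B := M * (1 - z) `^ (- m - 1) * z.
have Bg : geometric B z N @[N --> \oo] --> (0 : R).
  by apply: cvg_geometric; rewrite ger0_norm ?ltW.
apply/cvgrPdist_le => /= e e0; move/cvgrPdist_le : Bg => /(_ e e0).
apply: filterS => N; rewrite sub0r normrN /= => hN.
rewrite distrC; have [c /andP[c0 cz] ->] := binom_poly_estimate N m0 z01.
apply: le_trans hN; rewrite /B.
have c1 : 0 < 1 - c by lra.
have a1 : `|- (N.+1%:R * binom_coef m N.+1 * c ^+ N)| <= M * z ^+ N.
  rewrite normrN normrM ler_pM // normrX (ger0_norm (ltW c0)).
  by apply: lerXn2r => //; rewrite ?nnegrE ltW.
have a2 : (1 - c) `^ (- m - 1) <= (1 - z) `^ (- m - 1).
  rewrite -[- m - 1]opprK !(powRN _ (- _)) lef_pV2 ?posrE ?powR_gt0 //.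
  by apply: ge0_ler_powR; rewrite ?nnegrE; lra.
rewrite [leLHS]normrM [X in X * _ <= _]normrM.
rewrite (ger0_norm (ltW z0)) (ger0_norm (powR_ge0 (1 - c) _)).
rewrite [leRHS](_ : _ = M * z ^+ N * (1 - z) `^ (- m - 1) * z); last first.
  by rewrite ger0_norm ?mulr_ge0 ?powR_ge0 ?exprn_ge0 ?ltW // /B; ring.
by apply: ler_wpM2r; [exact: ltW | apply: ler_pM => //; rewrite powR_ge0].
Qed.
(** * Associated Legendre functions *)

(** The coefficient of z^k in 2F1(a + 1, -a; m + 1; z), without the factor 1 / Gamma(m + 1). *)
Definition hypF_coef (R : realType) (m a : R) (k : nat) : R :=
  poch (a + 1) k * poch (- a) k / (k`!%:R * poch (m + 1) k).

(** A contiguous relation of Gauss: the bracket is the coefficient of z^k in (1 - 2 z) F, where F is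
    the series for [a]. *)
Lemma hypF_coef_rec (R : realType) (m n : R) k : 0 <= m -> let a := m + n in
  (2 * m + n + 1) * hypF_coef m (a + 1) k =
  (2 * m + 2 * n + 1) *
    (hypF_coef m a k - 2 * (if k is k'.+1 then hypF_coef m a k' else 0))
  - n * hypF_coef m (a - 1) k.
Proof.
move=> m0 a; rewrite /hypF_coef; case: k => [|k].
  by rewrite !poch0 fact0 !mulr1 invr1; ring.
have m1 : 0 < m + 1 by lra.
have f0 : k`!%:R != 0 :> R by rewrite pnatr_eq0 -lt0n fact_gt0.
have p0 : poch (m + 1) k != 0 by rewrite gt_eqF // poch_gt0.
have p1 : m + 1 + k%:R != 0 by rewrite gt_eqF // ltr_wpDr.
have p2 : k%:R + 1 != 0 :> R by rewrite gt_eqF // ltr_wpDl.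
rewrite (pochSr (m + 1)) factS natrM -[k.+1%:R]natr1.
set Q := poch (a + 1) k; set T := poch (- a) k.
(* Shifting a by 1 changes the product of the two Pochhammer symbols by rational factors only, so
   all terms become multiples of Q T and [field] decides. *)
have -> : poch (a + 1 + 1) k.+1 * poch (- (a + 1)) k.+1 =
    - (Q * T) * (a + 1 + k%:R) * (a + 1 + k.+1%:R).
  rewrite (pochSl (- (a + 1))) (_ : - (a + 1) + 1 = - a); last by ring.
  have := pochSl (a + 1) k.+1; rewrite !(pochSr (a + 1)) -/Q -/T => e.
  rewrite [RHS](_ : _ = - T * (Q * (a + 1 + k%:R) * (a + 1 + k.+1%:R))); last by ring.
  by rewrite e; ring.
have -> : poch (a - 1 + 1) k.+1 * poch (- (a - 1)) k.+1 =
    - (Q * T) * (- a + k%:R) * (- a + k.+1%:R).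
  rewrite subrK (pochSl a) (_ : - (a - 1) = - a + 1); last by ring.
  have := pochSl (- a) k.+1; rewrite !(pochSr (- a)) -/Q -/T => e.
  rewrite [RHS](_ : _ = - Q * (T * (- a + k%:R) * (- a + k.+1%:R))); last by ring.
  by rewrite e; ring.
rewrite !pochSr -/Q -/T -[k.+1%:R]natr1 /a.
by field; rewrite f0 p0 p1.
Qed.

Lemma cvg_series_shift (R : realType) (u : nat -> R) (l : R) :
  series u @ \oo --> l ->
  series (fun k => if k is k'.+1 then u k' else 0) @ \oo --> l.
Proof.
move=> h; rewrite -cvg_shiftS.
suff -> : (fun N => series (fun k => if k is k'.+1 then u k' else 0) N.+1) = series u by [].
apply/funext => N; rewrite /series /= !big_mkord.
by rewrite big_ord_recl add0r.
Qed.

Lemma cvg_series_lin3 (R : realType) (x u v w : nat -> R) (a b c lu lv lw : R) :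
  (forall k, x k = a * u k + b * v k + c * w k) ->
  series u @ \oo --> lu -> series v @ \oo --> lv -> series w @ \oo --> lw ->
  series x @ \oo --> a * lu + b * lv + c * lw.
Proof.
move=> xE hu hv hw.
have -> : series x = (fun N => a * series u N + b * series v N + c * series w N).
  apply/funext => N; rewrite /series /= !mulr_sumr -!big_split /=.
  by apply: eq_bigr => k _; rewrite xE.
by apply: cvgD; [apply: cvgD|]; apply: cvgMl_tmp.
Qed.

(** For a = m the parameter m + 1 cancels between numerator and denominator, leaving the binomial
    series. *)
Lemma hypF_series0 (R : realType) (m z : R) : 0 <= m -> 0 < z < 1 ->
  series (fun k => hypF_coef m m k * z ^+ k) @ \oo --> (1 - z) `^ m.
Proof.
move=> m0 z01; have h := binomial_series m0 z01.
suff -> : (fun k => hypF_coef m m k * z ^+ k) = (fun k => binom_coef m k * z ^+ k) by [].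
apply/funext => k; congr (_ * _); rewrite /hypF_coef /binom_coef.
have p0 : poch (m + 1) k != 0 by rewrite gt_eqF // poch_gt0 //; lra.
by field; rewrite p0 pnatr_eq0 -lt0n fact_gt0.
Qed.

(* The three-term recurrence of the Gegenbauer polynomials C_n^(m + 1/2)
   in x = 1 - 2 z, read off the hypergeometric coefficients. *)
Lemma hypF_series_rec (R : realType) (m n z a b w : R) : 0 <= m -> 0 <= n -> 
  series (fun k => hypF_coef m (m + n) k * z ^+ k) @ \oo --> a * w ->
  (n != 0 -> series (fun k => hypF_coef m (m + n - 1) k * z ^+ k) @ \oo --> b * w) ->
  series (fun k => hypF_coef m (m + n + 1) k * z ^+ k) @ \oo -->
    ((2 * m + 2 * n + 1) * (1 - 2 * z) * a - n * b) / (2 * m + n + 1) * w.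
Proof.
move=> m0 n0 ha hb; set D := 2 * m + n + 1; have D0 : D != 0 by rewrite gt_eqF // /D; lra.
pose u k := hypF_coef m (m + n) k * z ^+ k.
pose v k := if k is k'.+1 then u k' else 0.
(* For n = 0 nothing is assumed about the lower series, and its factor n removes it. *)
pose y k := if n == 0 then 0 else hypF_coef m (m + n - 1) k * z ^+ k.
pose b' := if n == 0 then 0 else b.
have hy : series y @ \oo --> b' * w.
  rewrite /y /b'; case: eqVneq => [_|/hb //].
  suff -> : series (fun=> 0 : R) = (fun=> 0 * w) by exact: cvg_cst.
  by apply/funext => N; rewrite /series /= big1 ?mul0r.
have hv := cvg_series_shift ha.
have -> : ((2 * m + 2 * n + 1) * (1 - 2 * z) * a - n * b) / D * w =
    (2 * m + 2 * n + 1) / D * (a * w) + - (2 * m + 2 * n + 1) / D * 2 * z * (a * w)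
    + - n / D * (b' * w).
  by rewrite /b'; case: (eqVneq n 0) => [n_0|_]; rewrite ?n_0; field.
apply: (cvg_series_lin3 _ ha hv hy).
move=> k; have := hypF_coef_rec n k m0; rewrite /= -/D => e.
rewrite -[hypF_coef m (m + n + 1) k](mulKf D0) e /y.
have -> : - n / D * (if n == 0 then 0 else hypF_coef m (m + n - 1) k * z ^+ k) =
    - n / D * (hypF_coef m (m + n - 1) k * z ^+ k).
  by case: (eqVneq n 0) => // ->; rewrite oppr0 !mul0r.
by case: k {e} => [|k]; rewrite ?exprS; field.
Qed.

Lemma hypF_series_poly (R : realType) (m : R) (n : nat) : 0 <= m ->
  exists2 q : {poly R}, size q = n.+1 & forall z, 0 < z < 1 ->
  series (fun k => hypF_coef m (m + n%:R) k * z ^+ k) @ \oo --> q.[1 - 2 * z] * (1 - z) `^ m.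
Proof.
move=> m0; pose P (n : nat) (q : {poly R}) := size q = n.+1 /\
  forall z : R, 0 < z < 1 -> series (fun k => hypF_coef m (m + n%:R) k * z ^+ k) @ \oo
    --> q.[1 - 2 * z] * (1 - z) `^ m.
suff [[q [hq hqs]] _] : (exists q, P n q) /\ (exists q, P n.+1 q) by exists q.
(* One step of the recurrence, with q the current and p the previous polynomial. As 2 m + 2 n + 1 is
   not 0, the size grows by exactly one. *)
pose step (n : nat) (p q : {poly R}) : {poly R} :=
  (2 * m + n%:R + 1)^-1 *: ((2 * m + 2 * n%:R + 1) *: (q * 'X) - n%:R *: p).
have szstep i (p q : {poly R}) : size q = i.+1 -> (size p <= i.+1)%N -> size (step i p q) = i.+2.
  move=> sq sp; have i0 : 0 <= i%:R :> R by [].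
  rewrite /step size_scale ?invr_eq0 ?gt_eqF //; last by lra.
  have q0 : q != 0 by rewrite -size_poly_gt0 sq.
  have sX : size ((2 * m + 2 * i%:R + 1) *: (q * 'X)) = i.+2.
    rewrite size_scale ?size_mulX ?sq ?gt_eqF //; lra.
  by rewrite size_polyDl sX // size_polyN (leq_ltn_trans (size_scale_leq _ _)).
have hstep i (p q : {poly R}) (z : R) : (step i p q).[1 - 2 * z] =
    ((2 * m + 2 * i%:R + 1) * (1 - 2 * z) * q.[1 - 2 * z] - i%:R * p.[1 - 2 * z]) /
    (2 * m + i%:R + 1).
  rewrite /step hornerZ hornerD hornerN !hornerZ hornerMX (mulrC _ _^-1); congr (_ * _); ring.
have P0 : P 0%N 1.
  split=> [|z z01]; first by rewrite size_poly1.
  by rewrite hornerC mul1r addr0; exact: hypF_series0.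
elim: n => [|n [[p [sp hp]] [q [sq hq]]]].
  split; first by exists 1.
  (* The previous polynomial is a dummy here: it is multiplied by 0. *)
  exists (step 0%N 1 1); split=> [|z z01]; first by rewrite szstep ?size_poly1.
  rewrite hstep -natr1 addrA; apply: hypF_series_rec => //; first by apply: P0.2.
  by rewrite eqxx.
split; first by exists q.
exists (step n.+1 p q); split=> [|z z01]; first by rewrite szstep ?sp.
rewrite hstep -[n.+2%:R]natr1 addrA; apply: hypF_series_rec => //; first exact: hq.
by move=> _; rewrite -[n.+1%:R]natr1 addrA addrK; exact: hp.
Qed.
(** By [rgammaD] the factor 1 / Gamma(1 + m + k) supplies the denominator [poch (m + 1) k]; the
    constant [rgamma (m + 1)] that remains is positive, so the degree is preserved. *)
Lemma hyp2F1_reg_poly (R : realType) (m : R) (n : nat) : 0 <= m ->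
  exists2 q : {poly R}, size q = n.+1 & forall z, 0 < z < 1 ->
  hyp2F1_reg (m + n%:R + 1) (- (m + n%:R)) (1 + m) z = q.[1 - 2 * z] * (1 - z) `^ m.
Proof.
move=> m0; have m1 : 0 < m + 1 by lra.
have [q sq hq] := hypF_series_poly n m0; have g0 := rgamma_gt0 m1.
exists (rgamma (m + 1) *: q); first by rewrite size_scale // gt_eqF.
move=> z z01; rewrite hornerZ -mulrA; apply/cvg_lim => //.
suff -> : (fun k : nat => poch (m + n%:R + 1) k * poch (- (m + n%:R)) k / k`!%:R *
     rgamma (1 + m + k%:R) * z ^+ k) =
   rgamma (m + 1) *: (fun k => hypF_coef m (m + n%:R) k * z ^+ k).
  by rewrite seriesZ; apply: cvgMl_tmp; exact: hq.
apply/funext => k; rewrite (addrC 1) rgammaD // /hypF_coef.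
have p0 : poch (m + 1) k != 0 by rewrite gt_eqF // poch_gt0.
rewrite [RHS](_ : _ = rgamma (m + 1) * (poch (m + n%:R + 1) k *
  poch (- (m + n%:R)) k / (k`!%:R * poch (m + 1) k) * z ^+ k)) //.
by field; rewrite p0 pnatr_eq0 -lt0n fact_gt0.
Qed.

Lemma tP_norm_gt0 (R : realType) (j l n : nat) : (2 <= j)%N ->
  0 < tP_norm R j (l + n)%:Z l%:Z.
Proof.
move=> j2; rewrite sqrtr_gt0 mulr_gt0 ?divr_gt0 ?ltr0n ?fact_gt0 //.
rewrite ltr0z; lia.
Qed.

(** For x = cos t and s = sin t this merges the prefactor of P_nu^(-m) with the power (1 - z)^m at z
    = (1 - x)/2. It rests on ((1 + x)/2)^2 = ((1 + x)/(1 - x)) (s/2)^2, raised to the power m/2. *)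
Lemma powR_half_angle (R : realType) (m x s : R) : -1 < x < 1 -> 0 < s ->
  x ^+ 2 + s ^+ 2 = 1 ->
  ((1 + x) / (1 - x)) `^ (- m / 2) * (1 - (1 - x) / 2) `^ m = s `^ m * 2^-1 `^ m.
Proof.
move=> /andP[x1 x2] s0 xs.
have A0 : 0 < 1 + x by lra.
have B0 : 0 < 1 - x by lra.
have q0 : 0 < (1 + x) / (1 - x) by rewrite divr_gt0.
have -> : 1 - (1 - x) / 2 = (1 + x) / 2 by field.
have half (y : R) : 0 <= y -> y `^ m = (y ^+ 2) `^ (m / 2).
  move=> y0; rewrite -powR_mulrn // -powRrM; congr (_ `^ _); by field.
rewrite -powRM ?invr_ge0 ?(ltW s0) // (half ((1 + x) / 2)) ?(half (s / 2)); [|lra..].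
have -> : ((1 + x) / 2) ^+ 2 = ((1 + x) / (1 - x)) * (s * 2^-1) ^+ 2.
  have e : s ^+ 2 = 1 - x ^+ 2 by lra.
  have -> : (s * 2^-1) ^+ 2 = (1 - x ^+ 2) / 4 by rewrite -e; field.
  by field; lra.
have h0 : 0 < (s / 2) ^+ 2 by rewrite exprn_gt0 // divr_gt0.
rewrite (powRM _ (ltW q0) (ltW h0)).
by rewrite mulNr powRN mulKf // gt_eqF // powR_gt0.
Qed.

Lemma tP_open_poly (R : realType) (j l n : nat) : (2 <= j)%N ->
  exists2 q : {poly R}, size q = n.+1 & forall t : R, 0 < t < pi ->
  tP_open j (l + n)%:Z l%:Z t = sin t ^+ l * q.[cos t].
Proof.
move=> j2; set m : R := l%:R + (j%:R - 2) / 2.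
have j2' : 2 <= j%:R :> R by rewrite ler_nat.
have l0 : 0 <= l%:R :> R by [].
have m0 : 0 <= m by rewrite /m; lra.
have [q sq hq] := hyp2F1_reg_poly n m0.
have C0 : 0 < tP_norm R j (l + n)%:Z l%:Z * 2^-1 `^ m.
  by rewrite mulr_gt0 ?tP_norm_gt0 // powR_gt0.
exists ((tP_norm R j (l + n)%:Z l%:Z * 2^-1 `^ m) *: q).
  by rewrite size_scale // gt_eqF.
move=> t t0; rewrite hornerZ /tP_open /legendreP.
have s0 := sin_gt0_pi t0.
have c2 : cos t ^+ 2 < 1 by rewrite cos2sin2; have := exprn_gt0 2 s0; lra.
have c01 : -1 < cos t < 1 by apply/andP; split; nra.
have -> : (l + n)%:Z%:~R + (j%:R - 2) / 2 = m + n%:R :> R.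
  by rewrite /m -pmulrn natrD; ring.
have -> : l%:Z%:~R + (j%:R - 2) / 2 = m by [].
have -> : 1 - - m = 1 + m by rewrite opprK.
rewrite hq; last by case/andP: c01 => ? ?; apply/andP; split; lra.
have -> : 1 - 2 * ((1 - cos t) / 2) = cos t by field.
(* The exponents (2 - j)/2 and m = l + (j - 2)/2 add up to the natural number l. *)
have -> : sin t ^+ l = sin t `^ ((2 - j%:R) / 2) * sin t `^ m.
  rewrite -powRD ?(gt_eqF s0) ?implybT // -powR_mulrn ?(ltW s0) //.
  by congr (_ `^ _); rewrite /m; field.
have h := powR_half_angle m c01 s0 (cos2Dsin2 t).
rewrite (mulrA (_ `^ (- m / 2))) (mulrAC _ q.[_]) h.
ring.
Qed.
(** The formula of [tP_open_poly] is continuous on the whole line, so at 0 and pi the limit in [tP]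
    is its value there. *)
Lemma tP_poly (R : realType) (j l n : nat) : (2 <= j)%N ->
  exists2 q : {poly R}, size q = n.+1 & forall t : R, 0 <= t <= pi ->
  tP j (l + n)%:Z l%:Z t = sin t ^+ l * q.[cos t].
Proof.
move=> j2; have [q sq hq] := tP_open_poly R l n j2; exists q => // t t0.
rewrite /tP; case: ifPn => [|ht]; first exact: hq.
pose A : set R := `]0, pi[%classic.
have pi0 := pi_gt0 R.
(* This makes the filter of the one-sided limit proper, so that the limit is unique. *)
have clA : closure A t.
  move=> B /nbhs_ballP[e /= e0 eB].
  have [t_0|t_0] : t = 0 \/ t = pi.
    by move: t0 ht; case: (ltgtP 0 t) => //; case: (ltgtP t pi) => //; auto.
  - exists (Num.min (e / 2) (pi / 2)); split.
      rewrite /A /= in_itv /= lt_min gt_min; apply/andP; split; first by apply/andP; split; lra.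
      by apply/orP; right; lra.
    apply: eB; rewrite /ball /= t_0 sub0r normrN ger0_norm ?le_min ?gt_min; last first.
      by apply/andP; split; lra.
    by apply/orP; left; lra.
  - exists (pi - Num.min (e / 2) (pi / 2)); split.
      rewrite /A /= in_itv /= subr_gt0 gt_min gtrBl lt_min; apply/andP; split.
        by apply/orP; right; lra.
      by apply/andP; split; lra.
    apply: eB; rewrite /ball /= t_0 opprB addrC subrK ger0_norm ?le_min ?gt_min; last first.
      by apply/andP; split; lra.
    by apply/orP; left; lra.
have FA : ProperFilter (within A (nbhs t)) by exact: within_nbhs_proper.
apply: (@cvg_lim _ _ _ (within A (nbhs t))) => //.
pose f (s : R) := sin s ^+ l * q.[cos s].
have cf : f s @[s --> nbhs t] --> f t.
  have comp (p : {poly R}) (h : R -> R) : {for t, continuous h} ->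
      p.[h s] @[s --> nbhs t] --> p.[h t].
    by move=> ch; exact: (continuous_comp ch (@continuous_horner _ p (h t))).
  rewrite /f -hornerXn (_ : (fun s => sin s ^+ l * q.[cos s]) =
    (fun s => ('X^l).[sin s] * q.[cos s])); last by apply/funext => s; rewrite hornerXn.
  by apply: cvgM; apply: comp; [exact: continuous_sin | exact: continuous_cos].
have cf' : f s @[s --> within A (nbhs t)] --> f t.
  by apply: cvg_trans cf; exact: cvg_fmap2 (cvg_within _).
apply: (cvg_trans _ cf'); apply: near_eq_cvg; rewrite near_withinE; apply: nearW => s.
by rewrite /A /= in_itv /= => hs; rewrite hq.
Qed.
(** * Linear separation of points *)

(** Polynomials of every exact degree span all polynomials: a multiple of one of them cancels the
    top coefficient of p, and the size drops. *)
Lemma horner_span_sum0 (F : fieldType) (I : finType) (P : pred I) (v y : I -> F)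
    (q : nat -> {poly F}) :
  (forall n, size (q n) = n.+1) ->
  (forall n, \sum_(i | P i) v i * (q n).[y i] = 0) ->
  forall p : {poly F}, \sum_(i | P i) v i * p.[y i] = 0.
Proof.
move=> sq h p; have [n] := ubnP (size p); elim: n p => // n IH p; rewrite ltnS => sp.
case: n => [|n] in IH sp *.
  move: sp; rewrite leqn0 size_poly_eq0 => /eqP ->.
  by rewrite big1 // => i _; rewrite horner0 mulr0.
have lq : lead_coef (q n) != 0 by rewrite lead_coef_eq0 -size_poly_eq0 sq.
pose a := p`_n / lead_coef (q n); pose r := p - a *: q n.
have sr : (size r < n.+1)%N.
  rewrite ltnS; apply/leq_sizeP => j; rewrite leq_eqVlt => /orP[/eqP <-|nj].
    rewrite coefB coefZ /a.
    have -> : (q n)`_n = lead_coef (q n) by rewrite lead_coefE sq.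
    by rewrite divfK // subrr.
  rewrite coefB coefZ (nth_default 0 (leq_trans sp nj)) nth_default ?sq //.
  by rewrite mulr0 subr0.
have -> : \sum_(i | P i) v i * p.[y i] =
    \sum_(i | P i) v i * r.[y i] + a * \sum_(i | P i) v i * (q n).[y i].
  rewrite mulr_sumr -big_split /=; apply: eq_bigr => i _.
  by rewrite /r hornerD hornerN hornerZ; ring.
by rewrite IH // h mulr0 addr0.
Qed.

(** Test with a polynomial p that vanishes at all values of y other than c: only the fibre over c
    survives, multiplied by p(c), which is not 0. *)
Lemma fiber_sum0 (F : fieldType) (I : finType) (P : pred I) (v y : I -> F)
    (q : nat -> {poly F}) (c : F) :
  (forall n, size (q n) = n.+1) ->
  (forall n, \sum_(i | P i) v i * (q n).[y i] = 0) ->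
  \sum_(i | P i && (y i == c)) v i = 0.
Proof.
move=> sq h; pose s := [seq a <- [seq y i | i : I] | a != c].
pose p := \prod_(a <- s) ('X - a%:P).
have pc : p.[c] != 0.
  rewrite -/(root p c) root_prod_XsubC mem_filter eqxx //.
have := horner_span_sum0 sq h p; rewrite (bigID (fun i => y i == c)) /=.
rewrite [X in _ + X]big1 ?addr0 => [|i /andP[_ yc]].
  rewrite (eq_bigr (fun i => v i * p.[c])) => [|i /andP[_ /eqP ->] //].
  by rewrite -mulr_suml => /eqP; rewrite mulf_eq0 (negbTE pc) orbF => /eqP.
suff /eqP -> : root p (y i) by rewrite mulr0.
by rewrite root_prod_XsubC mem_filter yc; apply/mapP; exists i; rewrite ?mem_enum.
Qed.

Section Harmonics.
Local Open Scope complex_scope.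

Definition expi (R : realType) (t : R) : R[i] := cos t +i* sin t.

Lemma expi_natmul (R : realType) (t : R) n : expi (n%:R * t) = expi t ^+ n.
Proof.
elim: n => [|n IH]; first by rewrite mul0r /expi cos0 sin0 expr0.
rewrite exprS -IH -natr1 mulrDl mul1r addrC /expi cosD sinD.
by simpc; rewrite (addrC (sin t * _)).
Qed.

(* The factors of Y in the angles theta_1, ..., theta_m, for l_1 >= 0 and
   without the constant 1 / sqrt (2 pi). *)
Definition harm (R : realType) (m : nat) (l : nat -> nat) (theta : nat -> R) : R[i] :=
  expi ((l 1%N)%:R * theta 1%N) *
  (\prod_(2 <= j < m.+1) tP j (l j)%:Z (l j.-1)%:Z (theta j))%:C.

Lemma harmS (R : realType) m l (theta : nat -> R) :
  harm m.+2 l theta =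
  harm m.+1 l theta * (tP m.+2 (l m.+2)%:Z (l m.+1)%:Z (theta m.+2))%:C.
Proof. by rewrite /harm big_nat_recr //= rmorphM mulrA. Qed.

Lemma eq_harm (R : realType) m l l' (theta : nat -> R) :
  (forall j, (1 <= j <= m.+1)%N -> l j = l' j) ->
  harm m.+1 l theta = harm m.+1 l' theta.
Proof.
move=> e; apply: (f_equal2 (fun a b => expi (a%:R * theta 1%N) * b%:C)).
  exact: e.
apply: eq_big_nat => j /andP[j2 jm].
apply: (f_equal2 (fun a b => tP j a%:Z b%:Z (theta j))).
  by apply: e; rewrite (ltnW j2).
by apply: e; case: j j2 jm => [|[|j]] //= _ jm; rewrite ltnW.
Qed.

Definition angles_ok (R : realType) (d : nat) (theta : nat -> R) : Prop :=
  forall j, (2 <= j < d)%N -> 0 <= theta j <= pi.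

(* Equality of the points with polar coordinates theta_1, ..., theta_(k+1) on
   the sphere in dimension k + 2: below a vanishing sine, angles are irrelevant. *)
Fixpoint same_point (R : realType) (k : nat) (theta phi : nat -> R) : Prop :=
  match k with
  | 0%N => cos (theta 1%N) = cos (phi 1%N) /\ sin (theta 1%N) = sin (phi 1%N)
  | k'.+1 => cos (theta k.+1) = cos (phi k.+1) /\
             (sin (theta k.+1) = 0 \/ same_point k' theta phi)
  end.

Lemma sin_eq_of_cos (R : realType) (t u : R) :
  0 <= t <= pi -> 0 <= u <= pi -> cos t = cos u -> sin t = sin u.
Proof. by move=> t0 u0 /cos_inj -> //; rewrite in_itv. Qed.

(** For l = n = 0 the polynomial of [tP_poly] has size 1: it is a nonzero constant. *)
Lemma tP00_neq0 (R : realType) (j : nat) (t : R) : (2 <= j)%N -> 0 <= t <= pi ->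
  tP j 0 0 t != 0.
Proof.
move=> j2 t0; have [q sq hq] := tP_poly R 0 0 j2.
rewrite (hq _ t0) expr0 mul1r; have := sq; rewrite (size1_polyC (eq_leq sq)).
by rewrite size_polyC hornerC; case: eqP.
Qed.

Lemma harm0_neq0 (R : realType) m (theta : nat -> R) :
  angles_ok m.+1 theta -> harm m (fun=> 0%N) theta != 0.
Proof.
move=> ok; rewrite /harm mul0r /expi cos0 sin0 mul1r.
rewrite fmorph_eq0 prodf_seq_neq0; apply/allP => j; rewrite mem_index_iota => jm.
by apply/implyP => _; apply: tP00_neq0; [case/andP: jm | exact: ok].
Qed.

(** Induction on the dimension. A subset P and weights w are carried along because each step
    restricts the relation to the points with a given last cosine. *)
Lemma harm_separates (R : realType) (I : finType) (theta : I -> nat -> R) k :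
  (forall i, angles_ok k.+2 (theta i)) ->
  forall (P : pred I) (w : I -> R[i]),
  (forall l : nat -> nat, {homo l : i j / (i <= j)%N} ->
    \sum_(i | P i) w i * harm k.+1 l (theta i) = 0) ->
  (forall i j, P i -> P j -> same_point k (theta i) (theta j) -> i = j) ->
  forall i, P i -> w i = 0.
Proof.
elim: k => [|k IH] ok P w hw inj i0 Pi0.
  (* Base case: constant degrees l = n give the powers of exp(i theta_1), each value of which is
     attained at one point only. *)
  have h := @fiber_sum0 _ _ P w (fun i => expi (theta i 1%N)) (fun n => 'X^n)
    (expi (theta i0 1%N)) (fun n => size_polyXn _ n).
  rewrite (big_pred1 i0) in h; last first.
    move=> i /=; apply/andP/eqP => [[Pi /eqP[e1 e2]]|->]; last by split.
    by apply: inj => //; split.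
  apply: h => n; rewrite -[RHS](hw (fun=> n)) //; apply: eq_bigr => i _.
  by rewrite hornerXn /harm big_geq // mulr1 expi_natmul.
pose c i := (cos (theta i k.+2))%:C : R[i].
pose P' := [pred i | P i && (c i == c i0)].
have okk i : 0 <= theta i k.+2 <= pi by apply: ok; rewrite ltnSn.
have P's i : P' i -> sin (theta i k.+2) = sin (theta i0 k.+2).
  by move=> /andP[_ /eqP[e]]; apply: sin_eq_of_cos.
(* The degrees up to l_(k+1) stay fixed while the last one runs through l_(k+1) + n. The last factor
   is then a fixed power of the sine times a polynomial of degree n in the cosine, so the relation
   restricts to the fibre [P']. *)
have key l : {homo l : i j / (i <= j)%N} ->
    (sin (theta i0 k.+2) ^+ l k.+1)%:C *
      \sum_(i | P' i) w i * harm k.+1 l (theta i) = 0.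
  move=> hl.
  have /choice[q hq] : forall n, exists q : {poly R}, size q = n.+1 /\
      forall t : R, 0 <= t <= pi ->
        tP k.+2 (l k.+1 + n)%:Z (l k.+1)%:Z t = sin t ^+ l k.+1 * q.[cos t].
    by move=> n; have [q] := tP_poly R (l k.+1) n (isT : (2 <= k.+2)%N); exists q.
  pose l' n := fun j => if (j <= k.+1)%N then l j else (l k.+1 + n)%N.
  have hl' n : {homo l' n : i j / (i <= j)%N}.
    move=> i j ij; rewrite /l'; case: ifPn => [ik|].
      case: ifP => // _; first exact: hl.
      by apply: (leq_trans (hl _ _ ik)); rewrite leq_addr.
    by rewrite -ltnNge => ki; rewrite ifN // -ltnNge (leq_trans ki ij).
  have := @fiber_sum0 _ _ P
    (fun i => w i * harm k.+1 l (theta i) * (sin (theta i k.+2) ^+ l k.+1)%:C) c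
    (fun n => map_poly (real_complex R) (q n)) (c i0).
  rewrite mulr_sumr => h; rewrite -[RHS]h.
  - by apply: eq_bigr => i P'i; rewrite (P's _ P'i) mulrC.
  - by move=> n; rewrite size_map_poly; have [] := hq n.
  move=> n; rewrite -[RHS](hw _ (hl' n)); apply: eq_bigr => i _.
  rewrite harmS (@eq_harm _ k (l' n) l) => [|j /andP[_ jk]]; last by rewrite /l' jk.
  rewrite {1}/l' ltnn /l' leqnn; have [_ /(_ _ (okk i)) ->] := hq n.
  by rewrite /c horner_map rmorphM /= !mulrA.
(* At a pole the fibre is the single point i0, and taking all degrees 0 avoids the vanishing power
   of the sine. Elsewhere this power is cancelled and the induction hypothesis applies to the
   fibre. *)
have [s0|s0] := eqVneq (sin (theta i0 k.+2)) 0.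
  have := key (fun=> 0%N) (fun _ _ _ => leqnn _); rewrite expr0 mul1r.
  rewrite (big_pred1 i0) => [/eqP|i /=].
    rewrite mulf_eq0 (negbTE (harm0_neq0 _)) ?orbF => [/eqP //|j /andP[j2 jk]].
    by apply: ok; rewrite j2 ltnW.
  apply/andP/eqP => [[Pi /eqP[e]]|->]; last by split.
  by apply: inj => //; split=> //; left; rewrite P's // inE Pi /c e /=.
apply: (IH _ P' w) => //=.
- by move=> i j /andP[j2 jk]; apply: ok; rewrite j2 ltnW.
- move=> l hl; have /eqP := key l hl.
  by rewrite mulf_eq0 fmorph_eq0 expf_eq0 (negbTE s0) andbF => /eqP.
- move=> i j /andP[Pi /eqP[ei]] /andP[Pj /eqP[ej]] hs.
  by apply: inj => //; split; [rewrite ei ej | right].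
- by rewrite Pi0 eqxx.
Qed.

End Harmonics.
(** * Polar coordinates *)

(** The entries of [polar] with a natural number as index, which suits induction on the
    dimension. *)
Definition polar_coord (R : realType) (d : nat) (theta : nat -> R) (i : nat) : R :=
  (if i == 0%N then cos (theta 1%N)
   else if i == 1%N then sin (theta 1%N) else cos (theta i)) *
  \prod_(maxn 2 i.+1 <= j < d) sin (theta j).

Lemma polar_coordE (R : realType) d (theta : nat -> R) (i : 'I_d) :
  polar d theta 0 i = polar_coord d theta i.
Proof. by rewrite mxE. Qed.

Lemma polar_coordS (R : realType) k (theta : nat -> R) i : (i < k.+2)%N ->
  polar_coord k.+3 theta i = polar_coord k.+2 theta i * sin (theta k.+2).
Proof.
by move=> ik; rewrite /polar_coord big_nat_recr /= ?mulrA // geq_max ltnS.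
Qed.

Lemma polar_coord_last (R : realType) k (theta : nat -> R) :
  polar_coord k.+3 theta k.+2 = cos (theta k.+2).
Proof. by rewrite /polar_coord big_geq ?mulr1 // leq_max ltnSn orbT. Qed.

Lemma polar_coord2 (R : realType) (theta : nat -> R) i : (i < 2)%N ->
  polar_coord 2 theta i = if i == 0%N then cos (theta 1%N) else sin (theta 1%N).
Proof. by case: i => [|[|i]] // _; rewrite /polar_coord /= big_geq ?mulr1. Qed.

(** In the induction step all coordinates but the last carry the sine of the last angle as a factor;
    where it vanishes, the lower angles do not matter. *)
Lemma same_point_polar (R : realType) k (theta phi : nat -> R) :
  angles_ok k.+2 theta -> angles_ok k.+2 phi -> same_point k theta phi ->
  forall i, (i < k.+2)%N -> polar_coord k.+2 theta i = polar_coord k.+2 phi i.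
Proof.
elim: k => [|k IH] okt okp /=.
  by move=> [c s] i i2; rewrite !polar_coord2 // c s.
have sub (t : nat -> R) : angles_ok k.+3 t -> angles_ok k.+2 t.
  by move=> ok j /andP[j2 jk]; apply: ok; rewrite j2 ltnW.
move=> [c s] i; rewrite ltnS leq_eqVlt => /orP[/eqP ->|ik].
  by rewrite !polar_coord_last.
have e : sin (theta k.+2) = sin (phi k.+2).
  by apply: sin_eq_of_cos => //; [apply: okt | apply: okp]; rewrite ltnSn.
rewrite !polar_coordS // -e; case: s => [->|s]; first by rewrite !mulr0.
by rewrite (IH _ _ s _ ik) //; apply: sub.
Qed.

(** The angle is arccos(a / r), whose sine is nonnegative, as is b; if r = 0, any angle would do. *)
Lemma circle_param (R : realType) (a b : R) : 0 <= b ->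
  exists2 t : R, 0 <= t <= pi &
    a = Num.sqrt (a ^+ 2 + b ^+ 2) * cos t /\ b = Num.sqrt (a ^+ 2 + b ^+ 2) * sin t.
Proof.
move=> b0; set r := Num.sqrt _.
have r2 : r ^+ 2 = a ^+ 2 + b ^+ 2 by rewrite sqr_sqrtr // addr_ge0 ?sqr_ge0.
have [r0|r0] := eqVneq r 0.
  exists 0; first by rewrite lexx pi_ge0.
  move: r2; rewrite r0 expr0n /= => /esym/eqP.
  rewrite paddr_eq0 ?sqr_ge0 // !sqrf_eq0 => /andP[/eqP -> /eqP ->].
  by rewrite !mul0r.
have rp : 0 < r by rewrite lt_neqAle eq_sym r0 sqrtr_ge0.
have ar : -1 <= a / r <= 1.
  by rewrite ler_pdivlMr // ler_pdivrMr //; apply/andP; split; nra.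
exists (acos (a / r)); first by rewrite acos_ge0 ?acos_lepi.
rewrite acosK ?in_itv // sin_acos // mulrCA divff // mulr1; split=> //.
have -> : 1 - (a / r) ^+ 2 = (b / r) ^+ 2.
  by rewrite !expr_div_n r2; field; rewrite -r2 expf_neq0.
have br : 0 <= b / r by rewrite divr_ge0 // ltW.
by rewrite sqrtr_sqr (ger0_norm br) mulrCA divff // mulr1.
Qed.

Lemma circle_param_full (R : realType) (a b : R) :
  exists2 t : R, 0 <= t < 2 * pi &
    a = Num.sqrt (a ^+ 2 + b ^+ 2) * cos t /\ b = Num.sqrt (a ^+ 2 + b ^+ 2) * sin t.
Proof.
have pi0 := pi_gt0 R.
have [b0|b0] := leP 0 b.
  have [t /andP[t0 tpi] e] := circle_param a b0; exists t => //.
  by apply/andP; split; lra.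
have nb0 : 0 <= - b by lra.
have [t /andP[t0 tpi]] := circle_param a nb0; rewrite sqrrN => -[ea eb].
(* This excludes the angle 2 pi, which lies outside the half-open range. *)
have tn0 : t != 0 by apply/eqP => t_0; move: eb; rewrite t_0 sin0 mulr0; lra.
have tp : 0 < t by rewrite lt_neqAle eq_sym tn0.
exists (2 * pi - t); first by apply/andP; split; lra.
have -> : 2 * pi = pi *+ 2 :> R by rewrite mulr_natl.
rewrite cosB sinB cos2pi sin2pi !mul0r mul1r addr0 sub0r -ea.
by split=> //; rewrite mul1r mulrN -eb opprK.
Qed.

(** Stated for vectors of any norm, because the first coordinates of a unit vector need not form a
    unit vector. *)
Lemma polar_coords_exist (R : realType) k (x : nat -> R) :
  exists theta : nat -> R, [/\ 0 <= theta 1%N < 2 * pi, angles_ok k.+2 theta &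
    forall i, (i < k.+2)%N ->
      x i = Num.sqrt (\sum_(j < k.+2) x j ^+ 2) * polar_coord k.+2 theta i].
Proof.
elim: k => [|k [theta [t1 ok xE]]].
  have [t t0 [e1 e2]] := circle_param_full (x 0%N) (x 1%N).
  exists (fun=> t); split=> // [j|i i2]; first by case/andP=> /leq_trans h /h; rewrite ltnn.
  rewrite big_ord_recl big_ord1 polar_coord2 //=.
  by case: i i2 => [|[|i]].
set r := Num.sqrt (\sum_(j < k.+2) x j ^+ 2) in xE.
(* The new angle is that of the point (x_(k+2), r), where r >= 0 is the norm of the preceding
   coordinates. *)
have [t t0 [e1 e2]] := circle_param (x k.+2) (sqrtr_ge0 _ : 0 <= r).
pose th j := if j == k.+2 then t else theta j.
have rE : Num.sqrt (\sum_(j < k.+3) x j ^+ 2) = Num.sqrt (x k.+2 ^+ 2 + r ^+ 2).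
  rewrite big_ord_recr /= /r sqr_sqrtr; first by rewrite addrC.
  by apply: sumr_ge0 => i _; exact: sqr_ge0.
have thk : th k.+2 = t by rewrite /th eqxx.
exists th; split=> // [j /andP[j2 jk]|i]; rewrite ?rE.
  by rewrite /th; case: eqVneq => // jne; apply: ok; rewrite j2 ltn_neqAle jne.
rewrite ltnS leq_eqVlt => /orP[/eqP ->|ik].
  by rewrite polar_coord_last thk -e1.
rewrite polar_coordS // thk mulrCA -e2 mulrC xE //; congr (_ * _).
rewrite /polar_coord; congr (_ * _).
  by rewrite /th; case: i ik => [|[|i]] //= ik; rewrite ltn_eqF.
by apply: eq_big_nat => j /andP[_ jk]; rewrite /th ltn_eqF.
Qed.

Lemma sphere_polar_coords (R : realType) (d : nat) (xi : sphere R d) : (2 <= d)%N ->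
  exists theta, polar_coords theta xi.
Proof.
case: d xi => [|[|k]] // xi _.
pose x j : R := val xi 0 (inord j).
have [theta [t1 ok xE]] := polar_coords_exist k x.
exists theta; split => //; apply/rowP => i.
have s1 : \sum_(j < k.+2) x j ^+ 2 = 1.
  by rewrite -[RHS](eqP (valP xi)); apply: eq_bigr => j _; rewrite /x inord_val.
by have := xE i (ltn_ord i); rewrite s1 sqrtr1 mul1r polar_coordE /x inord_val.
Qed.
(** * Unconditional sums *)

(** Lists without repetition stand in for finite sets; A may repeat, since only its members
    count. *)
Lemma has_sum_seqP (C : numFieldType) (I : choiceType) (f : I -> C) (s : C) :
  has_sum f s <-> forall e : C, 0 < e -> exists A : seq I, forall B : seq I,
    uniq B -> {subset A <= B} -> `|s - \sum_(i <- B) f i| < e.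
Proof.
have FF := @summability.totally_filter I.
have psE (D : {fset I}) : summability.partial_sum f D = \sum_(i <- D) f i.
  by rewrite big_seq_fsetE.
split=> [/cvgrPdist_lt h e e0|h].
  have [A _ hA] := h e e0; exists A => B uB AB.
  have -> : \sum_(i <- B) f i = summability.partial_sum f [fset x in B]%fset.
    rewrite psE; apply: perm_big; apply: uniq_perm => //.
    by move=> i; rewrite !inE.
  by apply: hA => /=; apply/fsubsetP => i /AB; rewrite !inE.
apply/cvgrPdist_lt => e e0; have [A hA] := h e e0.
exists [fset x in A]%fset => // B /= /fsubsetP AB; rewrite psE.
by apply: hA => [|i iA]; [exact: fset_uniq | apply: AB; rewrite !inE].
Qed.

Lemma has_sum_lincomb (C : numFieldType) (I : choiceType) (J : finType)
    (k : J -> C) (f : J -> I -> C) (s : J -> C) :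
  (forall j, has_sum (f j) (s j)) ->
  has_sum (fun i => \sum_j k j * f j i) (\sum_j k j * s j).
Proof.
move=> h; have FF := @summability.totally_filter I.
have : forall r : seq J,
    has_sum (fun i => \sum_(j <- r) k j * f j i) (\sum_(j <- r) k j * s j).
  elim=> [|j r IH]; rewrite /has_sum.
    rewrite big_nil (_ : summability.partial_sum _ = fun=> 0); first exact: cvg_cst.
    apply/funext => A; rewrite /summability.partial_sum big1 // => i _.
    by rewrite big_nil.
  rewrite big_cons (_ : summability.partial_sum _ = fun A =>
      k j * summability.partial_sum (f j) A +
      summability.partial_sum (fun i => \sum_(j <- r) k j * f j i) A).
    by apply: cvgD; [apply: cvgMl_tmp; exact: h | exact: IH].
  apply/funext => A; rewrite /summability.partial_sum mulr_sumr -big_split /=.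
  by apply: eq_bigr => i _; rewrite big_cons.
exact.
Qed.

(** The terms >= 0 and the terms < 0 of D form two sublists that avoid A, and the assumed bound
    applies to each. *)
Lemma sum_abs_le (R : realDomainType) (I : eqType) (A : seq I) (h : I -> R) (M : R) :
  (forall D, uniq D -> {in D, forall i, i \notin A} -> `|\sum_(i <- D) h i| <= M) ->
  forall D, uniq D -> {in D, forall i, i \notin A} -> \sum_(i <- D) `|h i| <= M + M.
Proof.
move=> hM D uD dD; rewrite (bigID (fun i => 0 <= h i)) /=.
have sub (P : pred I) : `|\sum_(i <- D | P i) h i| <= M.
  rewrite -big_filter; apply: hM; first by rewrite filter_uniq.
  by move=> i; rewrite mem_filter => /andP[_ /dD].
apply: lerD; [apply: le_trans (sub (fun i => 0 <= h i)) |
  apply: le_trans (sub (fun i => ~~ (0 <= h i)))].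
  by apply: le_trans (ler_norm _); apply: ler_sum => i h0; rewrite ger0_norm.
rewrite -normrN -sumrN; apply: le_trans (ler_norm _).
by apply: ler_sum => i; rewrite -ltNge => h0; rewrite ltr0_norm.
Qed.

Section ComplexSums.
Local Open Scope complex_scope.

Lemma normc_Re_le (R : realType) (z : R[i]) : `|complex.Re z| <= Normc.normc z.
Proof. by case: z => a b /=; rewrite -sqrtr_sqr ler_wsqrtr // lerDl sqr_ge0. Qed.

Lemma normc_Im_le (R : realType) (z : R[i]) : `|complex.Im z| <= Normc.normc z.
Proof. by case: z => a b /=; rewrite -sqrtr_sqr ler_wsqrtr // lerDr sqr_ge0. Qed.

Lemma normc_le_ReIm (R : realType) (z : R[i]) : Normc.normc z <= `|complex.Re z| + `|complex.Im z|.
Proof.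
case: z => a b /=; rewrite -[leRHS]ger0_norm ?addr_ge0 // -sqrtr_sqr ler_wsqrtr //.
by rewrite sqrrD !real_normK ?num_real // addrAC lerDl mulrn_wge0 //.
Qed.

(** Cauchy's criterion: partial sums containing A are within 1 of s, so a sum over indices outside A
    has modulus at most 2. [sum_abs_le], applied to real and imaginary parts, turns this into a
    bound on sums of moduli. *)
Lemma has_sum_bounded (R : realType) (I : choiceType) (g : I -> R[i]) (s : R[i]) :
  has_sum g s -> exists M : R, forall D, uniq D -> \sum_(i <- D) Normc.normc (g i) <= M.
Proof.
move=> /has_sum_seqP /(_ 1 ltr01)[A0 hA0]; set A := undup A0.
have hA B : uniq B -> {subset A <= B} -> `|s - \sum_(i <- B) g i| < 1.
  by move=> uB AB; apply: hA0 => // i iA; apply: AB; rewrite mem_undup.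
have tail D : uniq D -> {in D, forall i, i \notin A} -> Normc.normc (\sum_(i <- D) g i) <= 2.
  move=> uD dD; rewrite -lecR -[(Normc.normc _)%:C]/(`|\sum_(i <- D) g i|).
  have uAD : uniq (A ++ D).
    rewrite cat_uniq undup_uniq uD andbT /=; apply/hasPn => i; exact: dD.
  have h1 := hA A (undup_uniq _) (fun _ => id).
  have h2 := hA _ uAD (mem_subseq (prefix_subseq _ _)).
  have -> : \sum_(i <- D) g i = (s - \sum_(i <- A) g i) - (s - \sum_(i <- A ++ D) g i).
    by rewrite big_cat /=; ring.
  apply: (le_trans (ler_normB _ _)).
  by rewrite rmorph_nat (_ : 2 = 1 + 1) // lerD // ltW.
(* One 2 + 2 is for the real parts outside A, the other for the imaginary parts. *)
pose M := \sum_(i <- A) Normc.normc (g i) + ((2 + 2) + (2 + 2)).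
have n0 (z : R[i]) : 0 <= Normc.normc z by case: z => a b /=; exact: sqrtr_ge0.
exists M => D uD; rewrite (bigID (fun i => i \in A)) /=; apply: lerD.
  rewrite -big_filter; set D' := [seq i <- D | i \in A].
  have -> : \sum_(i <- A) Normc.normc (g i) =
    \sum_(i <- D') Normc.normc (g i) + \sum_(i <- [seq i <- A | i \notin D']) Normc.normc (g i).
    rewrite -big_cat; apply: perm_big; apply: uniq_perm; first exact: undup_uniq.
      rewrite cat_uniq !filter_uniq ?undup_uniq // andbT /=.
      by apply/hasPn => i; rewrite !mem_filter => /andP[].
    move=> i; rewrite mem_cat !mem_filter.
    by case: (i \in A); rewrite ?andbF //= andbT orbN.
  by rewrite lerDl sumr_ge0.
rewrite -big_filter; set D' := [seq i <- D | i \notin A].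
have uD' : uniq D' by rewrite filter_uniq.
have dD' : {in D', forall i, i \notin A} by move=> i; rewrite mem_filter => /andP[].
apply: (@le_trans _ _ (\sum_(i <- D') (`|complex.Re (g i)| + `|complex.Im (g i)|))).
  by apply: ler_sum => i _; exact: normc_le_ReIm.
rewrite big_split /=; apply: lerD; apply: (@sum_abs_le _ _ A) => // B uB dB.
  rewrite -(raddf_sum (@complex.Re R)); exact: le_trans (normc_Re_le _) (tail _ uB dB).
rewrite -(raddf_sum (@complex.Im R)); exact: le_trans (normc_Im_le _) (tail _ uB dB).
Qed.

(** Supplies the absolute convergence that [calF] asks for. *)
Lemma has_sum_abs_summable (R : realType) (I : choiceType) (g : I -> R[i]) (s : R[i]) :
  has_sum g s -> abs_summable g.
Proof.
move=> /has_sum_bounded[M hM]; rewrite /abs_summable.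
apply: (@le_lt_trans _ _ M%:E); last exact: ltry.
apply: ge_ereal_sup => _ [F [finF _] <-].
by rewrite fsbig_finite // sumEFin lee_fin; apply: hM; exact: fset_uniq.
Qed.

End ComplexSums.

(** * Sums that are nonnegative on squares of index sets *)

Section Rectangles.
Variables (C : numFieldType) (J : choiceType) (L : J -> choiceType).
Let T2 (j : J) : choiceType := (L j * L j)%type.
Variable f : {j : J & T2 j} -> C.
Implicit Types (js : seq J) (B : forall j, seq (L j)).

Definition square j (b : seq (L j)) : seq (T2 j) := [seq (x, y) | x <- b, y <- b].

Definition squares js B : seq {j : J & T2 j} := [seq Tagged T2 p | j <- js, p <- square (B j)].

Lemma square_uniq j (b : seq (L j)) : uniq b -> uniq (square b).
Proof. by move=> ub; apply: allpairs_uniq => // -[x y] [x' y']. Qed.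

Lemma mem_squares js B u :
  (u \in squares js B) =
  [&& tag u \in js, (tagged u).1 \in B (tag u) & (tagged u).2 \in B (tag u)].
Proof.
apply/allpairsPdep/and3P => [[j [p [jj /allpairsP[[x y] [/= xB yB ->]] ->]]] //|].
case: u => j [x y] /= [jj xB yB]; exists j, (x, y); split=> //.
exact: allpairs_f.
Qed.

Lemma squares_uniq js B : uniq js -> (forall j, uniq (B j)) -> uniq (squares js B).
Proof.
move=> ujs uB; apply: allpairs_uniq_dep => // [j _|[j p] [j' p'] _ _ //].
exact: square_uniq.
Qed.

(** Squares are cofinal among the finite index sets: for each tag, B collects both components of the
    pairs in A with that tag, [untag] giving the empty list for the others. *)
Lemma squares_cover (A : seq {j : J & T2 j}) : exists js B,
  [/\ uniq js, forall j, uniq (B j) & {subset A <= squares js B}].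
Proof.
exists (undup [seq tag u | u <- A]).
exists (fun j => undup (flatten [seq untag [::] (fun p : T2 j => [:: p.1; p.2]) u | u <- A])).
split; [exact: undup_uniq | by move=> j; exact: undup_uniq|] => u uA.
rewrite mem_squares !mem_undup map_f //=.
have sub : {subset [:: (tagged u).1; (tagged u).2] <=
    flatten [seq untag [::] (fun p : T2 (tag u) => [:: p.1; p.2]) v | v <- A]}.
  move=> a au; apply/flattenP.
  exists (untag [::] (fun p : T2 (tag u) => [:: p.1; p.2]) u); first exact: map_f.
  by rewrite (untagE _ _ (erefl (tag u))).
by rewrite !sub // !inE eqxx ?orbT.
Qed.

Lemma big_squares js B :
  \sum_(u <- squares js B) f u =
  \sum_(j <- js) \sum_(p <- square (B j)) f (Tagged T2 p).
Proof. exact: big_allpairs_dep. Qed.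

Hypothesis f_square_ge0 : forall j (b : seq (L j)), uniq b ->
  0 <= \sum_(p <- square b) f (Tagged T2 p).

Lemma squares_ge0 js B : (forall j, uniq (B j)) -> 0 <= \sum_(u <- squares js B) f u.
Proof. by move=> uB; rewrite big_squares sumr_ge0 // => j _; exact: f_square_ge0. Qed.

(** A negative s would force the sum over some large union of squares to be negative. *)
Lemma has_sum_squares_ge0 s : s \is Num.real -> has_sum f s -> 0 <= s.
Proof.
move=> sr /has_sum_seqP h; have [//|s0] := real_leP (real0 C) sr.
have ns0 : 0 < - s by rewrite oppr_gt0.
have [A hA] := h _ ns0; have [js [B [ujs uB AB]]] := squares_cover A.
have := hA _ (squares_uniq ujs uB) AB.
have S0 := squares_ge0 js uB; rewrite distrC ger0_norm.
  by rewrite -[ltRHS]add0r ltrD2r => /(le_lt_trans S0); rewrite ltxx.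
by rewrite addr_ge0 // ltW.
Qed.

(** Sums over squares in the other fibres are nonnegative, so the total 0 cannot come from
    cancellation between fibres. *)
Lemma has_sum_fiber0 : has_sum f 0 ->
  forall j, has_sum (fun p : T2 j => f (Tagged T2 p)) 0.
Proof.
move=> /has_sum_seqP h j; apply/has_sum_seqP => e e0.
have e20 : 0 < e / 2 by rewrite divr_gt0.
have [A hA] := h _ e20; have [js [B [ujs uB AB]]] := squares_cover A.
pose js' := [seq i <- js | i != j]; pose H := squares js' B.
have H0 : 0 <= \sum_(u <- H) f u by exact: squares_ge0.
(* G replaces the square over j, while the other tags keep their squares; the union still contains
   A. *)
have ext G : uniq G -> {subset square (B j) <= G} ->
    `|\sum_(p <- G) f (Tagged T2 p) + \sum_(u <- H) f u| < e / 2.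
  move=> uG BG; rewrite -normrN -sub0r -(big_map (fun p : T2 j => Tagged T2 p) xpredT f).
  rewrite -big_cat; apply: hA.
    rewrite cat_uniq squares_uniq ?filter_uniq // andbT map_inj_uniq ?uG /=; last first.
      by move=> p p' /eqP; rewrite -tag_eqE /tag_eq eqxx /= tagged_asE => /eqP.
    apply/hasPn => u; rewrite mem_squares mem_filter => /and3P[/andP[uj _] _ _].
    by apply/negP => /mapP[p _ up]; rewrite up eqxx in uj.
  move=> u /AB; rewrite mem_cat !mem_squares mem_filter.
  have [uj|uj] := eqVneq (tag u) j; last by move=> ->; rewrite orbT.
  case: u uj => i [x y] /= ij; subst i => /and3P[_ xB yB].
  by rewrite map_f //; apply: BG; exact: allpairs_f.
(* If G is the square itself, both sums are nonnegative, so the one over H alone is below e / 2. The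
   triangle inequality then handles every other G, whose sum need not be real. *)
have He : \sum_(u <- H) f u < e / 2.
  have := ext _ (square_uniq (uB j)) (fun _ => id).
  have S0 := f_square_ge0 (uB j).
  rewrite ger0_norm ?addr_ge0 //; apply: le_lt_trans.
  by rewrite lerDr.
exists (square (B j)) => G uG BG; rewrite sub0r normrN.
rewrite -[X in `|X|](addrK (\sum_(u <- H) f u)) (splitr e).
apply: (le_lt_trans (ler_normB _ _)); apply: ltrD; first exact: ext.
by rewrite ger0_norm.
Qed.

End Rectangles.
(** * Strict positive definiteness *)

(** Turns the chains of degrees used with [harm] into indices of [Y]; only l_1 >= 0 arises in this
    way. *)
Lemma chain_Lambda (d : nat) (l : nat -> nat) : (2 <= d)%N -> {homo l : i j / (i <= j)%N} ->
  exists lam : Lambda d (l 1%N)%:Z, forall j, (1 <= j < d)%N -> mindex lam j = (l j)%:Z.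
Proof.
move=> d2 hl; pose f j := (l j)%:Z; pose s := map f (iota 2 (d - 2)).
have ss : size s == (d - 2)%N by rewrite size_map size_iota.
have ps : path <=%R `|(l 1%N)%:Z| (Tuple ss).
  have : sorted <=%R (map f (iota 1 (d - 2).+1)).
    apply: (@homo_sorted _ _ f leq); last exact: iota_sorted.
    by move=> i j ij; rewrite /f lez_nat hl.
  by rewrite /= ger0_norm.
exists (exist _ (Tuple ss) ps) => -[|[|j]] // /andP[_ jd]; rewrite /mindex /=.
by rewrite (nth_map 0%N) ?size_iota ?nth_iota // ltn_subRL.
Qed.

Section Separation.
Local Open Scope complex_scope.

Lemma Yangles_harm (R : realType) k (l : nat -> nat) (lam : Lambda k.+2 (l 1%N)%:Z)
    (theta : nat -> R) :
  (forall j, (1 <= j < k.+2)%N -> mindex lam j = (l j)%:Z) ->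
  Yangles lam theta = (1 / Num.sqrt (2 * pi))%:C * harm k.+1 l theta.
Proof.
move=> e; rewrite /Yangles /harm -mulrA.
apply: (f_equal (fun x : R => (1 / Num.sqrt (2 * pi))%:C *
  (expi ((l 1%N)%:R * theta 1%N) * x%:C))).
apply: eq_big_nat => j /andP[j2 jk].
apply: (f_equal2 (fun a b => tP j a b (theta j))); apply: e.
  by rewrite jk ltnW.
by case: j j2 jk => [|[|j]] //= _ jk; rewrite ltnW.
Qed.

Lemma Y_separates (R : realType) (d n : nat) (x : 'I_n -> sphere R d) (w : 'I_n -> R[i]) :
  (2 <= d)%N -> injective x ->
  (forall (l1 : int) (lam : Lambda d l1), \sum_i w i * Y lam (x i) = 0) ->
  forall i, w i = 0.
Proof.
case: d x => [|[|k]] // x _ xinj h i.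
(* This is the choice of angles made inside [Y]. Polar coordinates exist, so [xget] does not return
   its default. *)
pose theta i := xget (fun=> 0) [set t | polar_coords t (x i)].
have th j : polar_coords (theta j) (x j).
  have [t ht] := sphere_polar_coords (x j) isT.
  exact: (@xgetPex _ (fun=> 0) [set t | polar_coords t (x j)]) (ex_intro _ t ht).
have ok j : angles_ok k.+2 (theta j) by have [] := th j.
apply: (@harm_separates R _ theta k ok xpredT w) => // [l hl|a b _ _ sab].
  have [lam hlam] := chain_Lambda (isT : (2 <= k.+2)%N) hl.
  pose C : R[i] := (1 / Num.sqrt (2 * pi))%:C.
  have C0 : C != 0.
    by rewrite fmorph_eq0 mul1r invr_eq0 sqrtr_eq0 -ltNge mulr_gt0 // pi_gt0.
  have YE j : Y lam (x j) = C * harm k.+1 l (theta j) := Yangles_harm (theta j) hlam.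
  have e : C * \sum_i w i * harm k.+1 l (theta i) = \sum_i w i * Y lam (x i).
    by rewrite mulr_sumr; apply: eq_bigr => j _; rewrite YE mulrCA.
  by have /eqP := etrans e (h _ lam); rewrite mulf_eq0 (negbTE C0) => /eqP.
apply: xinj; apply: val_inj.
have [_ _ ->] := th a; have [_ _ ->] := th b.
by apply/rowP => j; rewrite !polar_coordE (same_point_polar _ _ sab).
Qed.

End Separation.

(** [psd_mx] conjugates the left vector, hence it is applied to the conjugates of the values of
    a. *)
Lemma psd_square_ge0 (C : numClosedFieldType) (Om : eqType) (K : Om -> Om -> C)
    (a : Om -> C) (b : seq Om) : positive_definite K -> uniq b ->
  0 <= \sum_(p <- [seq (y, z) | y <- b, z <- b]) a p.1 * K p.1 p.2 * (a p.2)^*.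
Proof.
move=> [_ pK] ub; have inj : injective (tnth (in_tuple b)).
  by apply/tuple_uniqP.
have := pK _ _ inj (\col_i (a (tnth (in_tuple b) i))^*).
rewrite [X in 0 <= X -> _](_ : _ =
  \sum_(p <- [seq (y, z) | y <- b, z <- b]) a p.1 * K p.1 p.2 * (a p.2)^*) //.
rewrite big_allpairs exchange_big /= big_tnth mxE; apply: eq_bigr => j _.
rewrite !mxE big_tnth mulr_suml; apply: eq_bigr => i _.
by rewrite !mxE conjCK.
Qed.
Theorem proposition2 (R : realType) (d : nat) (hd : (3 <= d)%N)
    (K : sphere R d -> sphere R d -> R[i]) (c : coeffs R d)
    (K_herm : hermitian_kernel K)
    (K_axial : axially_symmetric K)
    (K_expansion : has_expansion K c)
    (c_summable : coeffs_summable c)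
    (c_posdef : forall l1 : int, positive_definite (c l1))
    (F_full : calF c = [set: int]%classic) :
  strictly_positive_definite K.
Proof.
split=> // n x xinj v v0.
pose Q := \sum_i \sum_j (v i 0)^* * v j 0 * K (x i) (x j).
have -> : (v ^t* *m kernel_mx K x *m v)%sesqui 0 0 = Q.
  rewrite /Q exchange_big mxE; apply: eq_bigr => j _.
  by rewrite mxE mulr_suml; apply: eq_bigr => i _; rewrite !mxE mulrAC.
(* In [R[i]] only a real number can be compared with 0; that Q is real follows from the Hermitian
   symmetry of K. *)
have Qreal : Q \is Num.real.
  apply/CrealP; rewrite /Q rmorph_sum exchange_big /=; apply: eq_bigr => j _.
  rewrite rmorph_sum; apply: eq_bigr => i _.
  by rewrite (K_herm (x j)) !rmorphM /= !conjCK (mulrC (v j 0)).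
pose a (l1 : int) (l : Lambda d l1) : R[i] := \sum_i (v i 0)^* * Y l (x i).
pose f (u : coeff_index d) : R[i] :=
  a _ (tagged u).1 * c _ (tagged u).1 (tagged u).2 * (a _ (tagged u).2)^*.
(* A finite combination, over the pairs (i, j), of the expansions of K(x_i, x_j), factored at each
   index of the expansion. *)
have fQ : has_sum f Q.
  rewrite /Q pair_big /=.
  have := has_sum_lincomb (k := fun p : 'I_n * 'I_n => (v p.1 0)^* * v p.2 0)
    (fun p => K_expansion (x p.1) (x p.2)).
  rewrite (_ : (fun u => _) = f) //; apply/funext => u.
  rewrite -(pair_big xpredT xpredT (fun i j => (v i 0)^* * v j 0 *
    (c (tag u) (tagged u).1 (tagged u).2 * Y (tagged u).1 (x i) * (Y (tagged u).2 (x j))^*))) /=.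
  rewrite /f /a rmorph_sum /= mulrAC !mulr_suml; apply: eq_bigr => i _.
  rewrite mulr_sumr mulr_suml; apply: eq_bigr => j _.
  rewrite [((v j 0)^* * _)^*](rmorphM (Num.conj : {rmorphism R[i] -> R[i]})) /= conjCK; ring.
have f_ge0 (l1 : int) (b : seq (Lambda d l1)) : uniq b ->
    0 <= \sum_(p <- [seq (y, z) | y <- b, z <- b]) f (Tagged _ p).
  by move=> ub; exact: (psd_square_ge0 (a l1) (c_posdef l1) ub).
have Q0 : 0 <= Q by apply: (has_sum_squares_ge0 (f := f)).
rewrite lt_neqAle Q0 andbT; apply/negP => /eqP Q_0; move/eqP: v0; apply.
(* The weights in [a] are the conjugates of the v_i, so [Y_separates] is used to show that these
   vanish. *)
apply/colP => i; rewrite mxE; apply/eqP; rewrite -conjC_eq0; apply/eqP; move: i.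
apply: (Y_separates _ xinj) => [|l1 lam]; first exact: ltnW.
rewrite -Q_0 in fQ; have fib := has_sum_fiber0 (f := f) f_ge0 fQ l1.
have : calF c l1 by rewrite F_full.
by move=> /(_ (a l1)) /= H; exact: H (has_sum_abs_summable fib) fib lam.
Qed.
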